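(* For every $n\in\mathbb N$ there exists a probabilistic online monotone embedding (which may depend on $n$) of up to $n$ points from the real line into HSTs with distortion $O(\log n)$.
   Context: The real line carries the metric $|u-v|$. For $\mu\ge1$, a $\mu$-HST is the metric on the leaves of a rooted tree with node weights $\varphi\ge0$ ($\varphi(v)=0$ iff $v$ is a leaf, $\varphi(v)\le\varphi(u)/\mu$ when $v$ is a child of $u$), leaf distance $\varphi(\mathrm{lca}(u,v))$; ''HSTs'' is the family of such metrics. An update sequence is a sequence $(v_t,o_t)\in\mathbb R\times\{+,-\}$ ($v_t$ arrives if $o_t=+$, leaves if $o_t=-$) with alive sets $L_0=\varnothing$, $L_t=L_{t-1}\cup\{v_t\}$ or $L_{t-1}\setminus\{v_t\}$. A deterministic online monotone embedding outputs after $\sigma_t$ (depending only on $\sigma_1,\dots,\sigma_t$) an HST metric $d_t$ on $L_t$ with $d_t(u,v)\ge|u-v|$ on $L_t$ and $d_t(u,v)\le d_{t-1}(u,v)$ on $L_{t-1}\cap L_t$; a probabilistic one is a distribution over these (sequence fixed independently of the randomness), with distortion $\lambda$ if $\mathbb E[d_t(u,v)]\le\lambda|u-v|$ for all sequences with at most $n$ points, all $t$ and $u,v\in L_t$. *)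

(* Defs.v *)
From HB Require Import structures.
From mathcomp Require Import all_boot all_order all_algebra.
From mathcomp Require Import all_classical all_reals all_analysis.

Set Implicit Arguments.
Unset Strict Implicit.
Unset Printing Implicit Defensive.

Import Order.TTheory GRing.Theory Num.Theory.
Local Open Scope ring_scope.

Section HSTDefs.
Variable R : realType.

(** Update sequences: a finite list of updates (v, o) with o = true for
    arrival (+) and o = false for departure (-). *)
Definition update := (R * bool)%type.

Definition alive (s : seq update) : R -> bool :=
  foldl (fun (L : R -> bool) (p : update) =>
           fun x => if x == p.1 then p.2 else L x) (fun _ => false) s.

Definition npoints (s : seq update) : nat := size (undup (map fst s)).

Definition rooted_tree (V : finType) (root : V) (par : V -> V) : Prop :=
  par root = root /\ forall v : V, exists k : nat, iter k par v = root.

Definition is_leaf (V : finType) (root : V) (par : V -> V) (u : V) : Prop :=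
  forall v : V, v != root -> par v != u.

Definition ancestor (V : finType) (par : V -> V) (a v : V) : Prop :=
  exists k : nat, iter k par v = a.

Definition is_lca (V : finType) (par : V -> V) (w x y : V) : Prop :=
  ancestor par w x /\ ancestor par w y /\
  forall a, ancestor par a x -> ancestor par a y -> ancestor par a w.

(** d is a mu-HST metric on the (finite) set L : the leaves of a rooted tree
    with node weights phi are in bijection with L (via leaf), and
    d(u,v) = phi(lca(u,v)).  The empty set carries the (empty) HST metric. *)
Definition is_muHST (mu : R) (L : R -> bool) (d : R -> R -> R) : Prop :=
  (forall x, ~~ L x) \/
  exists (V : finType) (root : V) (par : V -> V) (phi : V -> R) (leaf : R -> V),
    [/\ rooted_tree root par,
        (forall v, 0 <= phi v),
        (forall v, phi v = 0 <-> is_leaf root par v) &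
        (forall v, v != root -> phi v <= phi (par v) / mu)] /\
    [/\ (forall x y, L x -> L y -> leaf x = leaf y -> x = y),
        (forall x, L x -> is_leaf root par (leaf x)),
        (forall w, is_leaf root par w -> exists2 x, L x & leaf x = w) &
        (forall x y, L x -> L y ->
           exists2 w, is_lca par w (leaf x) (leaf y) & d x y = phi w)].

Definition is_HST (L : R -> bool) (d : R -> R -> R) : Prop :=
  exists2 mu : R, 1 <= mu & is_muHST mu L d.

(** A deterministic online monotone embedding of up to n points of the real
    line into HSTs.  E s is the metric d_t output after the prefix s; being a
    function of the prefix, it is automatically online. *)
Definition det_online_monotone_embedding (n : nat)
    (E : seq update -> R -> R -> R) : Prop :=
  (forall s, (npoints s <= n)%N ->
     is_HST (alive s) (E s) /\
     forall u v, alive s u -> alive s v -> `|u - v| <= E s u v) /\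
  (forall s a, (npoints (rcons s a) <= n)%N ->
     forall u v, alive s u -> alive s v ->
       alive (rcons s a) u -> alive (rcons s a) v ->
       E (rcons s a) u v <= E s u v).

End HSTDefs.

(** A probabilistic online monotone embedding of up to n points with
    distortion lambda: a probability space (Omega, P) and a random choice
    E omega of deterministic embeddings (the update sequence is fixed
    independently of omega), with E[d_t(u,v)] <= lambda |u - v|. *)
Definition prob_online_monotone_embedding (R : realType) (n : nat) (lambda : R)
  : Prop :=
  exists (d : measure_display) (Omega : measurableType d)
         (P : probability Omega R) (E : Omega -> seq (update R) -> R -> R -> R),
    (forall w, det_online_monotone_embedding n (E w)) /\
    (forall s, (npoints s <= n)%N -> forall u v, alive s u -> alive s v ->
       measurable_fun setT (fun w => E w s u v) /\
       (\int[P]_w ((E w s u v)%:E) <= (lambda * `|u - v|)%:E)%E).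

(* Main.v *)
Require Import Defs.
From HB Require Import structures.
From mathcomp Require Import all_boot all_order all_algebra.
From mathcomp Require Import all_classical all_reals all_analysis.
From mathcomp Require Import measurable_realfun.
From mathcomp Require Import zify ring lra.
Import Order.TTheory GRing.Theory Num.Theory.
Local Open Scope ring_scope.

Set Implicit Arguments.
Unset Strict Implicit.
Unset Printing Implicit Defensive.

(** At every scale [2^i], [i] an integer, cut the line at one random point of each
    interval [[2^i k, 2^i (k+1)]], and let the distance of [u] and [v] be [6 * 2^i] for
    the largest scale at which a cut separates them. This ultrametric dominates the line,
    but each scale contributes [O(|u-v|)] to the expected distance, so all scales
    above [n^2 |u-v|] must be prevented from contributing. A cut is therefore deleted
    once it falls in a gap of length less than [2^i / n^2] between points that have
    arrived, unless one of its two neighbours already lies in such a gap. Deletions only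
    decrease distances, whence monotonicity; two adjacent cuts are never both deleted,
    whence domination. Between [u] and [v] with [n^2 |u-v| < 2^i] a cut survives only
    if a neighbouring cut also hits a short gap. As adjacent cuts are independent, for a
    gap of length [g] this adds [O(|u-v| g / 2^i)] to the expectation; summing over the
    scales with [2^i > n^2 g] gives [O(|u-v| / n^2)], and there are at most [n^2] pairs
    of points. Only the [O(log n)] scales between [|u-v|] and [n^2 |u-v|] remain, each
    costing [O(|u-v|)]. *)

(** * Finite ultrametrics as hierarchically separated trees *)

Section UltrametricTree.
Variables (R : realType) (T : finType) (D : T -> T -> R) (x0 : T).
Hypothesis Dxx : forall x, D x x = 0.
Hypothesis Dsym : forall x y, D x y = D y x.
Hypothesis Dgt0 : forall x y, x != y -> 0 < D x y.
Hypothesis Dmax : forall x y z, D x z <= Num.max (D x y) (D y z).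

(** Positions in this increasing list serve as tree levels. Position 0 holds the value 0, so weights
    vanish exactly at level 0. *)
Let radii : seq R := sort <=%R (undup [seq D p.1 p.2 | p <- enum [set: T * T]]).
Let top : nat := (size radii).-1.
Let rad (j : nat) : R := nth 0 radii j.

Let D_ge0 x y : 0 <= D x y.
Proof. by case: (eqVneq x y) => [->|/Dgt0/ltW //]; rewrite Dxx. Qed.

Let radii_sorted : sorted <%R radii.
Proof. by rewrite sort_lt_sorted undup_uniq. Qed.

Let mem_radii x y : D x y \in radii.
Proof.
by rewrite mem_sort mem_undup; apply/mapP; exists (x, y); rewrite ?mem_enum ?inE.
Qed.

Let radii_ge0 t : t \in radii -> 0 <= t.
Proof. by rewrite mem_sort mem_undup => /mapP[p _ ->]. Qed.

Let size_radii : size radii = top.+1.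
Proof. by rewrite prednK //; case: radii (mem_radii x0 x0). Qed.

Let rad_le i j : (i <= top)%N -> (j <= top)%N -> (rad i <= rad j) = (i <= j)%N.
Proof. by move=> hi hj; rewrite lt_sorted_leq_nth // inE size_radii ltnS. Qed.

Let rad_mem j : (j <= top)%N -> rad j \in radii.
Proof. by move=> hj; rewrite mem_nth // size_radii ltnS. Qed.

Let lev x y : nat := index (D x y) radii.

Let lev_top x y : (lev x y <= top)%N.
Proof. by rewrite -ltnS -size_radii index_mem mem_radii. Qed.

Let rad_lev x y : rad (lev x y) = D x y.
Proof. by rewrite /rad nth_index. Qed.

Let rad0 : rad 0 = 0.
Proof.
apply/le_anti; rewrite radii_ge0 ?rad_mem // andbT -[X in _ <= X](Dxx x0).
by rewrite -rad_lev rad_le.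
Qed.

(* [pick] depends only on the extension of its predicate, so this representative
   is common to a whole ball of radius [rad j]. *)
Let rep (j : nat) (x : T) : T := odflt x [pick y | D x y <= rad j].

Let D_rep j x : (j <= top)%N -> D x (rep j x) <= rad j.
Proof.
by move=> hj; rewrite /rep; case: pickP => //= _; rewrite Dxx radii_ge0 ?rad_mem.
Qed.

(** Every point of an ultrametric ball is a centre of it, so points of one ball pick the same
    representative. Conversely, [Dmax] is applied through the shared representative. *)
Let rep_eq j x y : (j <= top)%N -> (rep j x == rep j y) = (D x y <= rad j).
Proof.
move=> hj; apply/eqP/idP => [e|xy].
  rewrite (le_trans (Dmax x (rep j x) y)) // ge_max D_rep //= e Dsym.
  exact: D_rep.
have h : [pred z | D x z <= rad j] =1 [pred z | D y z <= rad j].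
  move=> z /=; apply/idP/idP => h.
    by rewrite (le_trans (Dmax y x z)) // ge_max Dsym xy.
  by rewrite (le_trans (Dmax x y z)) // ge_max xy.
rewrite /rep (eq_pick h); case: pickP => //= /(_ y) /=.
by rewrite Dxx radii_ge0 ?rad_mem.
Qed.

Let rep_rep i j x : (i <= j <= top)%N -> rep j (rep i x) = rep j x.
Proof.
move=> /andP[ij jt]; apply/eqP; rewrite rep_eq // Dsym.
have it := leq_trans ij jt.
by rewrite (le_trans (D_rep _ it)) // rad_le.
Qed.

Let rep0 x : rep 0 x = x.
Proof.
apply/eqP; apply: contraT => /Dgt0; rewrite Dsym => /lt_geF.
by have := D_rep x (leq0n top); rewrite rad0 => ->.
Qed.

(* A node is a ball of radius [rad j], encoded by its representative and [j]. *)
Let node : finType := {p : T * 'I_top.+1 | rep p.2 p.1 == p.1}.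

Let mk_proof j x :
  let p := (rep (minn j top) x, inord (minn j top) : 'I_top.+1) in
  rep p.2 p.1 == p.1.
Proof. by rewrite /= inordK ?ltnS ?geq_minr // rep_rep // leqnn geq_minr. Qed.

Let mk (j : nat) (x : T) : node :=
  exist (fun p : T * 'I_top.+1 => rep p.2 p.1 == p.1) _ (mk_proof j x).
Let level (v : node) : nat := (val v).2.
Let point (v : node) : T := (val v).1.

Let level_top v : (level v <= top)%N.
Proof. by rewrite -ltnS ltn_ord. Qed.

Let level_mk j x : (j <= top)%N -> level (mk j x) = j.
Proof. by move=> h; rewrite /level /= (minn_idPl h) inordK. Qed.

Let point_mk j x : (j <= top)%N -> point (mk j x) = rep j x.
Proof. by move=> h; rewrite /point /= (minn_idPl h). Qed.

Let mk_node v : mk (level v) (point v) = v.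
Proof.
apply: val_inj => /=; rewrite (minn_idPl (level_top v)).
case: v => -[x j] /= h; rewrite /level /point /=; congr pair.
  exact/eqP.
by apply: val_inj; rewrite /= inordK.
Qed.

Let mk_eq j x y : (j <= top)%N -> D x y <= rad j -> mk j x = mk j y.
Proof.
move=> h xy; apply: val_inj => /=; rewrite (minn_idPl h); congr pair.
by apply/eqP; rewrite rep_eq.
Qed.

Let mk_inj i j x y : (i <= top)%N -> (j <= top)%N ->
  mk i x = mk j y -> i = j /\ D x y <= rad j.
Proof.
move=> hi hj e; have eij : i = j by rewrite -(level_mk x hi) e level_mk.
split=> //; rewrite -rep_eq // -(point_mk y hj) -e point_mk // eij //.
Qed.

Let mk_rep i j x : (i <= j <= top)%N -> mk j (rep i x) = mk j x.
Proof.
move=> /andP[ij jt]; apply: mk_eq => //; rewrite Dsym.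
by rewrite (le_trans (D_rep _ (leq_trans ij jt))) // rad_le // (leq_trans ij).
Qed.

Let par (v : node) : node := mk (minn (level v).+1 top) (point v).
Let root : node := mk top x0.
Let phi (v : node) : R := rad (level v).

Let par_mk j x : (j <= top)%N -> par (mk j x) = mk (minn j.+1 top) x.
Proof.
move=> h; rewrite /par level_mk // point_mk // mk_rep // geq_minr andbT.
by rewrite leq_min leqnSn.
Qed.

Let iter_par k j x : (j <= top)%N -> iter k par (mk j x) = mk (minn (j + k) top) x.
Proof.
move=> h; elim: k => [|k IH]; first by rewrite addn0 (minn_idPl h).
rewrite iterS IH par_mk ?geq_minr //; congr mk; lia.
Qed.

Let radtop x y : D x y <= rad top.
Proof. by rewrite -rad_lev rad_le. Qed.

Let rooted : rooted_tree root par.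
Proof.
split; first by rewrite par_mk //; congr mk; lia.
move=> v; exists top; rewrite -[v]mk_node iter_par //.
by rewrite (minn_idPr (leq_addl _ _)); exact: mk_eq.
Qed.

Let nonroot_level v : v != root -> (level v < top)%N.
Proof.
move=> h; rewrite ltn_neqAle level_top andbT; apply: contraNneq h => e.
by rewrite -[v]mk_node e; apply/eqP/mk_eq.
Qed.

(** The same ball may occur at several levels. Hence every node above level 0 has a child, the ball
    one level down around its representative. *)
Let leaf_level v : is_leaf root par v <-> level v = 0%N.
Proof.
split=> [h|h u ur].
  apply/eqP; apply: contraT; rewrite -lt0n => lv.
  have lt := level_top v.
  pose u := mk (level v).-1 (point v).
  have hu : (level v).-1 = level u by rewrite level_mk //; lia.
  have /h/eqP[] : u != root.
    by apply: contraTneq lv => e; move: hu; rewrite e level_mk //; lia.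
  rewrite par_mk; last lia.
  by rewrite prednK // (minn_idPl lt) mk_node.
apply: contra_eqN h => /eqP <-.
by have := nonroot_level ur => lu; rewrite level_mk; lia.
Qed.

Let anc_leaf a x : ancestor par a (mk 0 x) <-> exists2 j, (j <= top)%N & a = mk j x.
Proof.
split=> [[k <-]|[j jt ->]].
  by exists (minn k top); rewrite ?geq_minr // iter_par.
by exists j; rewrite iter_par // (minn_idPl _).
Qed.

(** The common ancestors are the balls around [x] of radius at least [D x y], and [lev x y] is the
    lowest such level. *)
Let lcaP x y : is_lca par (mk (lev x y) x) (mk 0 x) (mk 0 y).
Proof.
split; first by apply/anc_leaf; exists (lev x y).
split.
  by apply/anc_leaf; exists (lev x y); rewrite // -?rad_lev; apply/mk_eq; rewrite ?rad_lev.
move=> a /anc_leaf[i it ->] /anc_leaf[j jt /(mk_inj it jt)[<-]].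
rewrite -rad_lev rad_le // => h; exists (i - lev x y)%N.
by rewrite iter_par //; congr mk; lia.
Qed.

Lemma ultrametric_tree :
  exists (V : finType) (root : V) (par : V -> V) (phi : V -> R) (leaf : T -> V),
    [/\ rooted_tree root par,
        (forall v, 0 <= phi v),
        (forall v, phi v = 0 <-> is_leaf root par v) &
        (forall v, v != root -> phi v <= phi (par v))] /\
    [/\ injective leaf,
        (forall x, is_leaf root par (leaf x)),
        (forall w, is_leaf root par w -> exists x, leaf x = w) &
        (forall x y, exists2 w, is_lca par w (leaf x) (leaf y) & D x y = phi w)].
Proof.
exists node, root, par, phi, (mk 0); split; split.
- exact: rooted.
- by move=> v; rewrite radii_ge0 // rad_mem.
- move=> v; rewrite leaf_level /phi; split=> [/eqP h|->]; last exact: rad0.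
  by move: h; rewrite eq_le -rad0 rad_le // leqn0 => /andP[/eqP].
- move=> v /nonroot_level h; rewrite /phi rad_le //.
  by rewrite level_mk ?geq_minr //; lia.
- move=> x y /mk_inj[] // _; rewrite rad0 => h.
  by apply/eqP; apply: contraT => /Dgt0; rewrite ltNge h.
- by move=> x; apply/leaf_level; rewrite level_mk.
- by move=> w /leaf_level h; exists (point w); rewrite -{2}[w]mk_node h.
- move=> x y; exists (mk (lev x y) x); first exact: lcaP.
  by rewrite /phi level_mk // rad_lev.
Qed.

End UltrametricTree.

Lemma ultrametric_is_HST (R : realType) (L : R -> bool) (S : seq R)
    (d : R -> R -> R) :
  (forall x, L x -> x \in S) ->
  (forall x, d x x = 0) -> (forall x y, d x y = d y x) ->
  (forall x y, x != y -> 0 < d x y) ->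
  (forall x y z, d x z <= Num.max (d x y) (d y z)) ->
  is_HST L d.
Proof.
move=> LS dxx dsym dgt0 dmax; exists 1 => //.
(* A point of [L] is needed as base point of the tree and as default value of [sub]. *)
have [L0|/existsNP[x0 /negP/negPn Lx0]] := pselect (forall x, ~~ L x); first by left.
right; pose T := seq_sub [seq x <- S | L x].
have LT x : L x -> x \in [seq x <- S | L x] by move=> h; rewrite mem_filter h LS.
pose sub x : T := insubd (SeqSub (LT x0 Lx0)) x.
have subK x : L x -> val (sub x) = x by move=> /LT h; rewrite insubdK.
have valL (x : T) : L (val x).
  by have := valP x; rewrite mem_filter => /andP[].
have [||||V [root [par [phi [leaf [[h1 h2 h3 h4] [h5 h6 h7 h8]]]]]]] :=
  @ultrametric_tree R T (fun x y => d (val x) (val y)) (sub x0) => //.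
  by move=> x y ?; apply: dgt0; rewrite (inj_eq val_inj).
exists V, root, par, phi, (leaf \o sub); split; split=> //.
- by move=> v /h4; rewrite divr1.
- by move=> x y Lx Ly /h5/(congr1 val); rewrite !subK.
- by move=> x _; exact: h6.
- move=> w /h7[x <-]; have e : sub (val x) = x by apply: val_inj; rewrite subK.
  by exists (val x) => //; rewrite /comp e.
- move=> x y Lx Ly /=; have [w hw] := h8 (sub x) (sub y).
  by rewrite !subK //; exists w.
Qed.

(** * The random cuts and the ultrametric they define *)

Section RandomCuts.
Variables (R : realType) (n : nat) (w : R * R).
Implicit Types (i k : int) (s : seq (update R)) (u v x y z : R).

(** The uniform law charges only [[0, 1]], but an embedding is required for every [w]; clamping
    makes the cuts well placed for all of them. *)
Definition clamp x : R := Num.max 0 (Num.min 1 x).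

(* One coordinate serves all even [k] and the other all odd [k], so adjacent cut
   points of a scale are independent. Nothing is needed across scales. *)
Definition offset k : R := clamp (if odd `|k|%N then w.2 else w.1).

(* Cell [k] of scale [i] is cut in its middle half: no cut of a large scale comes
   near the origin, so any two points are unseparated at all large scales. *)
Definition cutpt i k : R := 2 ^ i * (k%:~R + 4^-1 + offset k / 2).

Definition weak i k (S : seq R) : bool :=
  has (fun p : R * R => (p.1 < cutpt i k <= p.2) && ((p.2 - p.1) * n%:R ^+ 2 < 2 ^ i))
    (allpairs pair S S).

(* The prefix makes deletion irreversible, and two adjacent cuts are never both
   deleted since weakness persists when points are added. *)
Definition deleted i k s : bool :=
  has (fun m => let S := map fst (take m s) in
         [&& weak i k S, ~~ weak i (k - 1) S & ~~ weak i (k + 1) S])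
    (iota 0 (size s).+1).

(** With the half-open convention each cut splits the line into exactly two sides, so a third point
    always falls on one of them; this gives [apart_trans]. *)
Definition apart i s u v : Prop :=
  exists k, (Num.min u v < cutpt i k <= Num.max u v) && ~~ deleted i k s.

(* [sup] of the empty set is [0], which is the value for [u = v]. *)
Definition cutdist s u v : R :=
  sup [set 6 * 2 ^ i | i in [set i | apart i s u v]]%classic.

Lemma scale_gt0 i : 0 < 2 ^ i :> R.
Proof. exact: exprz_gt0. Qed.

Lemma cutpt_bounds i k :
  2 ^ i * (k%:~R + 4^-1) <= cutpt i k <= 2 ^ i * (k%:~R + 3 / 4).
Proof.
have : 0 <= offset k <= 1 by rewrite /offset /clamp le_max lexx ge_max ler01 ge_min lexx.
move=> /andP[h0 h1]; rewrite /cutpt !ler_pM2l ?scale_gt0 //; apply/andP; split; lra.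
Qed.

Lemma weak_sub i k (S S' : seq R) : {subset S <= S'} -> weak i k S -> weak i k S'.
Proof.
move=> sub /hasP[p /allpairsP[q [h1 h2 ->]] h]; apply/hasP; exists (q.1, q.2) => //.
by apply: allpairs_f; exact: sub.
Qed.

Lemma weak_take i k s m m' : (m <= m')%N ->
  weak i k (map fst (take m s)) -> weak i k (map fst (take m' s)).
Proof.
move=> mm; apply: weak_sub => x; rewrite -(take_takel s mm) map_take.
exact: mem_take.
Qed.

(** When either cut is deleted it is weak and the other is not. The one deleted first stays weak,
    which forbids the later deletion of the other. *)
Lemma deleted_adjacent i k s : deleted i k s -> ~~ deleted i (k + 1) s.
Proof.
move=> /hasP[m _ /and3P[m0 _ m1]]; apply/negP => /hasP[m' _ /and3P[m'0 m'1 _]].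
rewrite addrK in m'1.
case/orP: (leq_total m m') => mm.
- by move/negP: m'1; apply; exact: weak_take m0.
- by move/negP: m1; apply; exact: weak_take m'0.
Qed.

Lemma deleted_rcons i k s a : deleted i k s -> deleted i k (rcons s a).
Proof.
move=> /hasP[m]; rewrite mem_iota add0n ltnS => /= ms h; apply/hasP; exists m.
  by rewrite mem_iota size_rcons add0n ltnS (leq_trans ms).
by rewrite -cats1 takel_cat.
Qed.

Lemma apart_rcons i s a u v : apart i (rcons s a) u v -> apart i s u v.
Proof.
move=> [k /andP[h1 h2]]; exists k; rewrite h1 /=.
by apply: contra h2; exact: deleted_rcons.
Qed.

Lemma apartC i s u v : apart i s u v -> apart i s v u.
Proof. by rewrite /apart minC maxC. Qed.

Lemma apart_refl i s u : ~ apart i s u u.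
Proof. by move=> [k]; rewrite minxx maxxx => /andP[/andP[/lt_le_trans h /h]]; rewrite ltxx. Qed.

Lemma apart_trans i s u v z :
  apart i s u z -> apart i s u v \/ apart i s v z.
Proof.
move=> [k /andP[/andP[h1 h2] h3]].
have : (Num.min u v < cutpt i k <= Num.max u v) || (Num.min v z < cutpt i k <= Num.max v z).
  move: h1 h2; rewrite !gt_min !le_max.
  by case: (ltP u (cutpt i k)); case: (ltP v (cutpt i k)); case: (ltP z (cutpt i k)).
by case/orP => h; [left|right]; exists k; rewrite h h3.
Qed.

Lemma dist_minmax u v : `|u - v| = Num.max u v - Num.min u v.
Proof.
case: (leP u v) => h; first by rewrite distrC ger0_norm // subr_ge0.
by rewrite gtr0_norm // subr_gt0.
Qed.

(** The first two cells starting beyond the smaller point have their cut points within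
    [11 / 4 * 2 ^ i] of it, and at least one of these cuts survives. *)
Lemma far_apart i s u v : 3 * 2 ^ i <= `|u - v| -> apart i s u v.
Proof.
rewrite dist_minmax; set a := Num.min u v; set b := Num.max u v => far.
have D0 := scale_gt0 i; set D : R := 2 ^ i in far D0 *.
set k := Num.floor (a / D) + 1.
have /andP[kl ku] := floor_itv (a / D); rewrite -/k in ku.
have kE : (Num.floor (a / D))%:~R = k%:~R - 1 :> R by rewrite /k intrD; lra.
rewrite {}kE ler_pdivlMr // in kl; rewrite ltr_pdivrMr // in ku.
have /andP[c0l c0u] := cutpt_bounds i k.
have /andP[c1l c1u] := cutpt_bounds i (k + 1).
rewrite -/D in c0l c0u; rewrite -/D intrD mulr1z in c1l c1u.
have [del|ndel] := boolP (deleted i k s).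
- exists (k + 1); rewrite deleted_adjacent // andbT -/a -/b; apply/andP; split; lra.
- exists k; rewrite ndel andbT -/a -/b; apply/andP; split; lra.
Qed.

(** Cut points keep a distance of at least [2 ^ i / 4] from the origin. This makes [sup] a true
    supremum and later truncates the sum over scales. *)
Lemma apart_scale i s u v : apart i s u v -> 2 ^ i <= 4 * (`|u| + `|v|).
Proof.
move=> [k /andP[/andP[h1 h2] _]].
have /andP[cl cu] := cutpt_bounds i k; have D0 := scale_gt0 i.
set D : R := 2 ^ i in cl cu D0 *.
have [k0|k0] := leP 0 k.
- have : 0 <= k%:~R :> R by rewrite ler0z.
  have := ler_norm u; have := ler_norm v; have := normr_ge0 u; have := normr_ge0 v.
  by move: h2; rewrite le_max => /orP[]; nra.
- have : k%:~R <= -1 :> R by rewrite (_ : -1 = (-1)%:~R) // ler_int; lia.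
  have := ler_norm (- u); have := ler_norm (- v); rewrite !normrN.
  have := normr_ge0 u; have := normr_ge0 v.
  by move: h1; rewrite gt_min => /orP[]; nra.
Qed.

Let radii s u v : set R := [set 6 * 2 ^ i | i in [set i | apart i s u v]]%classic.

Let radii_ub s u v : has_ubound (radii s u v).
Proof.
exists (24 * (`|u| + `|v|)) => _ [i /apart_scale h <-]; lra.
Qed.

Lemma le_cutdist i s u v : apart i s u v -> 6 * 2 ^ i <= cutdist s u v.
Proof. by move=> h; apply: ub_le_sup; [exact: radii_ub|exists i]. Qed.

Lemma cutdist_le s u v c : 0 <= c ->
  (forall i, apart i s u v -> 6 * 2 ^ i <= c) -> cutdist s u v <= c.
Proof.
rewrite /cutdist -/(radii s u v) => c0 h.
have [->|/set0P ne] := eqVneq (radii s u v) set0; first by rewrite sup0.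
by apply: sup_le_ub => // _ [i hi <-]; exact: h.
Qed.
Lemma scale_bracket x : 0 < x -> exists i, 2 ^ i <= x < 2 ^ (i + 1).
Proof.
move=> x0; have ln2 : 0 < ln 2 :> R by rewrite ln_gt0 // ltr1n.
have pw i : 2 ^ i = expR (i%:~R * ln 2) :> R.
  by rewrite -powR_intmul // /powR pnatr_eq0.
exists (Num.floor (ln x / ln 2)); rewrite !pw.
have /andP[h1 h2] := floor_itv (ln x / ln 2).
rewrite -[x in _ <= x](lnK x0) -[x in x < _](lnK x0).
by rewrite ler_expR ltr_expR -ler_pdivlMr // -ltr_pdivrMr // h1.
Qed.

(** The scale with [3 * 2 ^ i <= |u - v| < 6 * 2 ^ i] separates the points by [far_apart]; the upper
    bound explains the factor 6 in [cutdist]. *)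
Lemma norm_le_cutdist s u v : `|u - v| <= cutdist s u v.
Proof.
have [->|uv] := eqVneq u v.
  rewrite subrr normr0 /cutdist (_ : [set i | _]%classic = set0) ?image_set0 ?sup0 //.
  by rewrite -subset0 => i /apart_refl.
have /scale_bracket[i /andP[h1 h2]] : 0 < `|u - v| / 3.
  by rewrite divr_gt0 // normr_gt0 subr_eq0.
rewrite expfzDr ?pnatr_eq0 // expr1z in h2.
have /le_cutdist : apart i s u v by apply: far_apart; lra.
by apply: le_trans; lra.
Qed.

Lemma cutdist_ge0 s u v : 0 <= cutdist s u v.
Proof. exact: le_trans (norm_le_cutdist s u v). Qed.

Lemma cutdistxx s u : cutdist s u u = 0.
Proof.
by apply/le_anti; rewrite cutdist_ge0 cutdist_le // => i /apart_refl.
Qed.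

Lemma cutdistC s u v : cutdist s u v = cutdist s v u.
Proof.
by apply/le_anti; rewrite !cutdist_le ?cutdist_ge0 // => i /apartC; exact: le_cutdist.
Qed.

Lemma cutdist_max s u v z :
  cutdist s u z <= Num.max (cutdist s u v) (cutdist s v z).
Proof.
apply: cutdist_le => [|i /(apart_trans v)[] h]; rewrite le_max.
- by rewrite cutdist_ge0.
- by rewrite le_cutdist.
- by rewrite orbC le_cutdist.
Qed.

Lemma cutdist_rcons s a u v : cutdist (rcons s a) u v <= cutdist s u v.
Proof.
apply: cutdist_le => [|i /apart_rcons]; first exact: cutdist_ge0.
exact: le_cutdist.
Qed.

End RandomCuts.

Lemma alive_mem (R : realType) (s : seq (update R)) x : alive s x -> x \in map fst s.
Proof.
rewrite /alive; suff H L : foldl (fun (L : R -> bool) (p : update R) =>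
           fun x => if x == p.1 then p.2 else L x) L s x -> L x \/ x \in map fst s.
  by move=> /H[].
elim: s L => [|p s IH] L /=; first by left.
move=> /IH[]; last by rewrite inE => ->; rewrite orbT; right.
by case: eqP => [->|_]; [rewrite inE eqxx; right|left].
Qed.

(** * Probabilities of the cuts *)

Section GeneralMeasurability.
Local Open Scope classical_set_scope.

(** Union bound. Measurability is returned as well, so that the bound can be nested. *)
Lemma measure_bigsetU_le d (T : measurableType d) (R : realType)
    (mu : {measure set T -> \bar R}) (I : Type) (s : seq I) (P : pred I)
    (F : I -> set T) (f : I -> R) :
  (forall i, P i -> measurable (F i)) ->
  (forall i, P i -> (mu (F i) <= (f i)%:E)%E) ->
  measurable (\big[setU/set0]_(i <- s | P i) F i) /\
  (mu (\big[setU/set0]_(i <- s | P i) F i) <= (\sum_(i <- s | P i) f i)%:E)%E.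
Proof.
move=> mF hF; elim: s => [|i s [IHm IH]]; first by rewrite !big_nil measure0.
rewrite !big_cons; case: ifPn => // Pi; split.
  by apply: measurableU => //; exact: mF.
rewrite EFinD; apply: le_trans (measureU2 _ (mF _ Pi) IHm) _.
by apply: leeD => //; exact: hF.
Qed.

Lemma measurable_has d (T : measurableType d) (I : eqType) (s : seq I)
    (f : I -> T -> bool) : (forall i, measurable [set w | f i w]) ->
  measurable [set w | has (f^~ w) s].
Proof.
move=> mf; elim: s => [|i s IH] /=.
  by rewrite (_ : [set w | _] = set0) // -subset0.
have -> : [set w | f i w || has (f^~ w) s] = [set w | f i w] `|` [set w | has (f^~ w) s].
  by apply/seteqP; split=> w /= => [/orP|h]; [|apply/orP].
exact: measurableU.
Qed.

End GeneralMeasurability.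

Section CutProbability.
Local Open Scope classical_set_scope.
Variable R : realType.

Let U := uniform_prob (@ltr01 R).
Let Omega := (measurableTypeR R * measurableTypeR R)%type.

Definition cut_prob : probability Omega R := [the probability _ _ of (U \x U)%E].

Let P := cut_prob.

Lemma measurable_clamp : measurable_fun [set: R] (@clamp R).
Proof.
by apply: measurable_maxr => //; apply: measurable_minr.
Qed.

Let strip i k a b : set R :=
  [set x | a < 2 ^ i * (k%:~R + 4^-1 + clamp x / 2) <= b].

Lemma measurable_strip i k a b : measurable (strip i k a b).
Proof.
have -> : strip i k a b =
    (fun x => 2 ^ i * (k%:~R + 4^-1 + clamp x / 2)) @^-1` `]a, b].
  by apply/seteqP; split => x /=; rewrite in_itv.
rewrite -[X in measurable X]setTI; apply: (_ : measurable_fun _ _) => //.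
apply: measurable_funM => //; apply: measurable_funD => //.
by apply: measurable_funM => //; exact: measurable_clamp.
Qed.

(** The cut point moves with slope [2 ^ i / 2] in the coordinate, whence the factor 2; [al] and [be]
    are the coordinates that would put it at [a] and [b]. *)
Lemma prob_strip i k a b : a <= b -> (U (strip i k a b) <= (2 * (b - a) / 2 ^ i)%:E)%E.
Proof.
move=> ab; rewrite /U /uniform_prob integral_uniform_pdf.
have D0 := scale_gt0 R i.
set A := strip i k a b `&` _.
have mA : measurable A by apply: measurableI => //; exact: measurable_strip.
apply: (@le_trans _ _ (\int[lebesgue_measure]_(x in A) (cst 1 x))%E).
  apply: ge0_le_integral => //.
  - by move=> x _; rewrite lee_fin uniform_pdf_ge0.
  - by apply/measurable_EFinP/measurable_funTS; exact: measurable_uniform_pdf.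
  - move=> x _; rewrite /uniform_pdf /= lee_fin subr0 invr1.
    by case: ifP.
rewrite integral_cst // mul1e.
set al : R := 2 * (a / 2 ^ i - k%:~R - 4^-1); set be : R := 2 * (b / 2 ^ i - k%:~R - 4^-1).
have albe : be - al = 2 * (b - a) / 2 ^ i by rewrite /al /be; field; exact: lt0r_neq0.
have sub : A `<=` `]al, be].
  move=> x [] /= /andP[h1 h2]; rewrite !in_itv /= => /andP[x0 x1].
  have xE : clamp x = x by rewrite /clamp (min_idPr x1) (max_idPr x0).
  rewrite xE mulrC -ltr_pdivrMr // in h1; rewrite xE mulrC -ler_pdivlMr // in h2.
  rewrite /al /be; apply/andP; split; lra.
have mI : measurable (`]al, be] : set R) by exact: measurable_itv.
have leA : (lebesgue_measure A <= lebesgue_measure (`]al, be] : set R))%E.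
  by apply: le_measure; rewrite ?inE.
apply: (le_trans leA); have -> : lebesgue_measure (`]al, be] : set R) = (if (al < be)%R then (be - al)%:E else 0)%E.
  by rewrite lebesgue_measure_itv /= lte_fin -EFinB.
case: ifP => _.
  by rewrite albe.
by rewrite lee_fin divr_ge0 ?mulr_ge0 ?subr_ge0 ?(ltW D0).
Qed.

(** Indices of opposite parity read different coordinates, so the event is a rectangle and its
    probability a product. *)
Lemma prob_strip_pair i k k' a b a' b' : odd `|k|%N != odd `|k'|%N -> a <= b -> a' <= b' ->
  let A := [set w : Omega | (a < cutpt w i k <= b) && (a' < cutpt w i k' <= b')] in
  measurable A /\ (P A <= (2 * (b - a) / 2 ^ i * (2 * (b' - a') / 2 ^ i))%:E)%E.
Proof.
move=> odk ab ab' A.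
have [->|->] : A = strip i k a b `*` strip i k' a' b' \/
               A = strip i k' a' b' `*` strip i k a b.
  case ok: (odd `|k|%N) odk; case ok': (odd `|k'|%N) => // _; [right|left];
    apply/seteqP; split=> w /=; rewrite /A /strip /setX /= /cutpt /offset; rewrite ok ok';
    by [move=> /andP[]|move=> [-> ->]].
all: split; [by apply: measurableX; exact: measurable_strip|].
all: rewrite /P /= product_measure1E; [|exact: measurable_strip..].
all: rewrite EFinM 1?[X in (_ <= X)%E]muleC.
- by rewrite muleC; apply: lee_pmul => //; exact: prob_strip.
- by apply: lee_pmul => //; exact: prob_strip.
Qed.

Lemma prob_cutpt i k a b : a <= b ->
  let A := [set w : Omega | a < cutpt w i k <= b] in
  measurable A /\ (P A <= (2 * (b - a) / 2 ^ i)%:E)%E.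
Proof.
move=> ab A.
have [->|->] : A = setT `*` strip i k a b \/ A = strip i k a b `*` setT.
  case ok: (odd `|k|%N); [left|right];
    apply/seteqP; split=> w /=; rewrite /A /strip /setX /= /cutpt /offset ok;
    by [move=> -> | case].
all: split; [by apply: measurableX => //; exact: measurable_strip|].
all: rewrite /P /= product_measure1E //; try exact: measurable_strip.
all: rewrite [X in (X * _)%E]probability_setT ?mul1e || rewrite [X in (_ * X)%E]probability_setT ?mule1.
all: exact: prob_strip.
Qed.

(** * Measurability of the random distance *)

Section Separation.
Variable n : nat.

Lemma measurable_cutpt i k a b : measurable [set w : Omega | a < cutpt w i k <= b].
Proof.
have [ab|ba] := leP a b; first by have [] := prob_cutpt i k ab.
rewrite (_ : [set w | _] = set0) // -subset0 => w /= /andP[h1 h2].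
by have := lt_trans ba (lt_le_trans h1 h2); rewrite ltxx.
Qed.

Lemma measurable_andb (f g : Omega -> bool) :
  measurable [set w | f w] -> measurable [set w | g w] ->
  measurable [set w | f w && g w].
Proof.
move=> mf mg; rewrite (_ : [set w | _] = [set w | f w] `&` [set w | g w]).
  exact: measurableI.
by apply/seteqP; split=> w /= /andP.
Qed.

Lemma measurable_negb (f : Omega -> bool) :
  measurable [set w | f w] -> measurable [set w | ~~ f w].
Proof.
move=> mf; rewrite (_ : [set w | _] = ~` [set w | f w]); first exact: measurableC.
by apply/seteqP; split=> w /= /negP.
Qed.

Lemma measurable_weak i k (S : seq R) : measurable [set w : Omega | weak n w i k S].
Proof.
apply: (@measurable_has _ _ _ _ (fun p w => (p.1 < cutpt w i k <= p.2) && _)) => p.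
apply: measurable_andb; first exact: measurable_cutpt.
have [_|_] := boolP (_ < _).
  by rewrite (_ : [set w | _] = setT) //; apply/seteqP.
by rewrite (_ : [set w | _] = set0) // -subset0.
Qed.

Lemma measurable_deleted i k (s : seq (update R)) :
  measurable [set w : Omega | deleted n w i k s].
Proof.
apply: (@measurable_has _ _ _ _ (fun m w =>
   [&& weak n w i k (map fst (take m s)), ~~ weak n w i (k - 1) (map fst (take m s))
     & ~~ weak n w i (k + 1) (map fst (take m s))])) => m.
by apply: measurable_andb; [|apply: measurable_andb; apply: measurable_negb];
  exact: measurable_weak.
Qed.

Lemma measurable_apart i (s : seq (update R)) u v :
  measurable [set w : Omega | apart n w i s u v].
Proof.
rewrite (_ : [set w | _] = \bigcup_(k : int)
    [set w | (Num.min u v < cutpt w i k <= Num.max u v) && ~~ deleted n w i k s]).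
  apply: countable_bigcupT_measurable => [|k]; first exact: countableP.
  apply: measurable_andb; first exact: measurable_cutpt.
  by apply: measurable_negb; exact: measurable_deleted.
by apply/seteqP; split=> w [k]; exists k.
Qed.

Lemma measurable_cutdist (s : seq (update R)) u v :
  measurable_fun [set: Omega] (fun w => cutdist n w s u v).
Proof.
move=> mT; apply: (measurability _ (RGenOInfty.measurableE R)) => //.
move=> /= _ [_ [c ->] <-]; apply: measurableI => //.
have [c0|c0] := ltP c 0.
  rewrite (_ : _ @^-1` _ = setT) //; apply/seteqP; split=> w //= _.
  by rewrite in_itv /= andbT (lt_le_trans c0) // cutdist_ge0.
(* For [0 <= c] the supremum exceeds [c] only through some separating scale, and there are countably
   many scales. *)
rewrite (_ : _ @^-1` _ = \bigcup_(i : int)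
    [set w | apart n w i s u v /\ c < 6 * 2 ^ i]).
  apply: countable_bigcupT_measurable => [|i]; first exact: countableP.
  have [h|h] := boolP (c < 6 * 2 ^ i).
    rewrite (_ : [set w | _] = [set w | apart n w i s u v]).
      exact: measurable_apart.
    by apply/seteqP; split=> w //= [].
  by rewrite (_ : [set w | _] = set0) // -subset0 => w /= [_].
apply/seteqP; split=> w /=; rewrite in_itv /= andbT.
- move=> cd; apply: contrapT => h.
  suff: cutdist n w s u v <= c by rewrite leNgt cd.
  apply: cutdist_le => // i ai; rewrite leNgt; apply/negP => ci.
  by apply: h; exists i.
- by move=> [i _ [ai ci]]; apply: lt_le_trans ci _; exact: le_cutdist.
Qed.

End Separation.
End CutProbability.

(** * Expected distance *)

Lemma odd_absz_succ (k : int) : odd `|(k + 1)%R|%N = ~~ odd `|k|%N.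
Proof. lia. Qed.

Lemma odd_absz_pred (k : int) : odd `|(k - 1)%R|%N = ~~ odd `|k|%N.
Proof. lia. Qed.

(** Cut point [k] lies in cell [k], and an interval shorter than a cell meets at most two cells. *)
Lemma cutpt_cell (R : realType) (w : R * R) (i k : int) (a b : R) :
  b - a < 2 ^ i -> a < cutpt w i k <= b ->
  (k == Num.floor (a / 2 ^ i)) || (k == Num.floor (a / 2 ^ i) + 1).
Proof.
set k0 := Num.floor _ => ab /andP[h1 h2]; have D0 := scale_gt0 R i.
have /andP[kl ku] := floor_itv (a / 2 ^ i); rewrite -/k0 in kl ku.
have /andP[cl cu] := cutpt_bounds w i k.
set D : R := 2 ^ i in ab D0 kl ku cl cu.
rewrite ler_pdivlMr // in kl; rewrite ltr_pdivrMr // intrD mulr1z in ku.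
have g1 : (k0 < k + 1)%R.
  rewrite -(ltr_int R) intrD mulr1z -(ltr_pM2r D0); lra.
have g2 : (k < k0 + 2)%R.
  rewrite -(ltr_int R) intrD -(ltr_pM2r D0) (_ : 2%:~R = 2 :> R) //; lra.
lia.
Qed.

(** The retained terms halve from one to the next. The [max] lets the induction replace [y] by
    [2 * y], whether or not the first term is retained. *)
Lemma geometric_tail (R : realType) (M : nat) (y T : R) : 0 < y -> 0 < T ->
  \sum_(j < M | T < y * 2 ^+ j) (y * 2 ^+ j)^-1 <= 2 / Num.max T y.
Proof.
elim: M y => [|M IH] y y0 T0.
  by rewrite big_ord0 divr_ge0 // le_max (ltW y0) orbT.
rewrite big_mkcond big_ord_recl expr0 mulr1 -big_mkcond /=.
have -> : \sum_(j < M | T < y * 2 ^+ (bump 0 j)) (y * 2 ^+ (bump 0 j))^-1 =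
          \sum_(j < M | T < 2 * y * 2 ^+ j) (2 * y * 2 ^+ j)^-1.
  by apply: eq_big => j; rewrite /bump /= add1n exprS (mulrC 2 y) mulrA.
have y20 : 0 < 2 * y by rewrite mulr_gt0.
apply: le_trans (lerD (lexx _) (IH _ y20 T0)) _.
have [Ty|yT] := ltP T y.
- rewrite (max_idPr (_ : T <= 2 * y)); last lra.
  by rewrite le_eqVlt; apply/orP; left; apply/eqP; field; lra.
- rewrite add0r ler_pM2l // lef_pV2 ?posrE ?lt_max ?T0 //.
  by rewrite le_max lexx.
Qed.

Lemma sum_lt_const (R : realType) (M J : nat) (c : R) :
  \sum_(j < M) (if (j < J)%N then c else 0) = (minn M J)%:R * c.
Proof.
elim: M => [|M IH]; first by rewrite big_ord0 min0n mul0r.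
rewrite big_ord_recr /= IH; case: ltnP => h.
  by rewrite (minn_idPl h) -[in RHS]natr1 mulrDl mul1r.
by rewrite addr0 (minn_idPr (leqW h)).
Qed.

Section Expectation.
Local Open Scope classical_set_scope.
Variables (R : realType) (n : nat).
Let P := @cut_prob R.

(** Deletions are ignored: a union bound over the two candidate cuts suffices. *)
Lemma prob_apart_near i (s : seq (update R)) u v : `|u - v| < 2 ^ i ->
  (P [set w | apart n w i s u v] <= (4 * `|u - v| / 2 ^ i)%:E)%E.
Proof.
rewrite dist_minmax; set a := Num.min u v; set b := Num.max u v => gi.
have ab : a <= b by rewrite /a /b ge_min le_max lexx.
set k0 := Num.floor (a / 2 ^ i).
pose F k := [set w : R * R | a < cutpt w i k <= b].
have [m h] := @measure_bigsetU_le _ _ _ P _ [:: k0; k0 + 1] xpredT F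
   (fun=> 2 * (b - a) / 2 ^ i) (fun k _ => (prob_cutpt i k ab).1)
   (fun k _ => (prob_cutpt i k ab).2).
have -> : 4 * (b - a) / 2 ^ i = \sum_(k <- [:: k0; k0 + 1]) (2 * (b - a) / 2 ^ i).
  by rewrite !big_cons big_nil; ring.
apply: le_trans h; apply: le_measure; rewrite ?inE //; first exact: measurable_apart.
move=> w [k /andP[h _]]; rewrite !big_cons big_nil setU0.
by have := cutpt_cell gi h; rewrite -/k0 => /orP[/eqP<-|/eqP<-]; [left|right].
Qed.

(* A surviving cut between points of [s] this close is weak, so a neighbouring cut
   point falls in a short gap too; the two events are independent. *)
Lemma prob_apart_far i (s : seq (update R)) u v :
  u \in map fst s -> v \in map fst s -> `|u - v| * n%:R ^+ 2 < 2 ^ i ->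
  `|u - v| < 2 ^ i ->
  (P [set w | apart n w i s u v] <=
   (\sum_(p <- allpairs pair (undup (map fst s)) (undup (map fst s)) |
      ((0 < p.2 - p.1) && ((p.2 - p.1) * n%:R ^+ 2 < 2 ^ i))%R)
      (16 * `|u - v| * (p.2 - p.1) / (2 ^ i) ^+ 2))%:E)%E.
Proof.
move=> us vs; rewrite dist_minmax; set a := Num.min u v; set b := Num.max u v.
set S := undup _ => giN gi; have D0 := scale_gt0 R i.
have ab : a <= b by rewrite /a /b ge_min le_max lexx.
have aS : a \in map fst s by rewrite /a; case: ltP.
have bS : b \in map fst s by rewrite /b; case: ltP.
set k0 := Num.floor (a / 2 ^ i).
pose Q (p : R * R) := (0 < p.2 - p.1) && ((p.2 - p.1) * n%:R ^+ 2 < 2 ^ i).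
pose F (q : int * int) (p : R * R) := [set w : R * R |
  (a < cutpt w i q.1 <= b) && (p.1 < cutpt w i q.2 <= p.2)].
pose f (p : R * R) := 2 * (b - a) / 2 ^ i * (2 * (p.2 - p.1) / 2 ^ i).
(* Each of the two candidate cells is paired with its two neighbours. *)
pose K : seq (int * int) := [:: (k0, k0 - 1); (k0, k0 + 1);
  (k0 + 1, k0 + 1 - 1); (k0 + 1, k0 + 1 + 1)].
pose odq (q : int * int) := odd `|q.1|%N != odd `|q.2|%N.
have hF q p : odq q -> Q p -> measurable (F q p) /\ (P (F q p) <= (f p)%:E)%E.
  move=> oq /andP[p0 _]; apply: prob_strip_pair => //; lra.
have hG q : odq q -> measurable (\big[setU/set0]_(p <- allpairs pair S S | Q p) F q p) /\
    (P (\big[setU/set0]_(p <- allpairs pair S S | Q p) F q p) <=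
     (\sum_(p <- allpairs pair S S | Q p) f p)%:E)%E.
  by move=> oq; apply: (@measure_bigsetU_le _ _ _ P _ _ Q (F q) f) => p Qp; have [] := hF q p oq Qp.
have [m h] := @measure_bigsetU_le _ _ _ P _ K odq
  (fun q => \big[setU/set0]_(p <- allpairs pair S S | Q p) F q p)
  (fun=> \sum_(p <- allpairs pair S S | Q p) f p)
  (fun q oq => (hG q oq).1) (fun q oq => (hG q oq).2).
apply: (@le_trans _ _ (\sum_(q <- K | odq q) \sum_(p <- allpairs pair S S | Q p) f p)%:E).
  apply: le_trans h; apply: le_measure; rewrite ?inE //; first exact: measurable_apart.
  move=> w [k /andP[h /hasPn nd]].
  have wk : weak n w i k (map fst (take (size s) s)).
    rewrite take_size; apply/hasP; exists (a, b); first exact: allpairs_f.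
    by rewrite h giN.
  (* At the full prefix the cut is weak yet not deleted, so one of its neighbours is weak. *)
  have := nd (size s); rewrite mem_iota /= add0n ltnSn => /(_ isT).
  rewrite wk /= take_size negb_and !negbK => wk'.
  have [k' [kk' wkk']] : exists k', (k' = k - 1 \/ k' = k + 1) /\ weak n w i k' (map fst s).
    by case/orP: wk' => ?; [exists (k - 1)|exists (k + 1)]; split; auto.
  have qK : (k, k') \in K /\ odq (k, k').
    rewrite /odq /K !inE !xpair_eqE /=.
    have := cutpt_cell gi h; rewrite -/k0 => kk0.
    by case: kk' => ->; case/orP: kk0 => /eqP->;
      rewrite ?eqxx /= ?orbT; split=> //; rewrite ?odd_absz_pred ?odd_absz_succ; case: odd.
  move: wkk' => /hasP[p /allpairsP[[p1 p2] /= [p1S p2S ->]] /= /andP[hp pN]].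
  rewrite -bigcup_seq_cond; exists (k, k') => //=; first by rewrite qK.1 qK.2.
  rewrite -bigcup_seq_cond; exists (p1, p2) => /=; last by rewrite /F /= h hp.
  rewrite /Q /= pN andbT subr_gt0 (lt_le_trans (andP hp).1 (andP hp).2) andbT.
  by apply: allpairs_f; rewrite mem_undup.
rewrite lee_fin.
have f0 : 0 <= \sum_(p <- allpairs pair S S | Q p) f p.
  apply: sumr_ge0 => p /andP[/ltW p0 _].
  by rewrite mulr_ge0 // divr_ge0 ?(ltW D0) // mulr_ge0 // subr_ge0.
apply: (@le_trans _ _ (\sum_(q <- K) \sum_(p <- allpairs pair S S | Q p) f p)).
  by rewrite [leLHS]big_mkcond; apply: ler_sum => q _; case: ifP.
rewrite !big_cons big_nil addr0.
(* The constant 16 is four pairs of cells times a factor 2 from each of the two strips. *)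
suff -> : \sum_(p <- allpairs pair S S | Q p)
    (16 * (b - a) * (p.2 - p.1) / (2 ^ i) ^+ 2) =
  4 * \sum_(p <- allpairs pair S S | Q p) f p by lra.
rewrite mulr_sumr; apply: eq_bigr => p _; rewrite /f; field.
exact: lt0r_neq0.
Qed.

End Expectation.

(** * Summation over the scales *)

Section ExpectedDistortion.
Local Open Scope classical_set_scope.
Variables (R : realType) (n : nat).
Hypothesis n1 : (1 < n)%N.
Let P := @cut_prob R.

(** After exchanging the sums, a pair with gap [d] meets only scales above [d * n ^ 2]; the
    geometric tail cancels [d] and leaves [192 * g / n ^ 2] for each of at most [n ^ 2] pairs. The
    constant 96 is 6 times 16. *)
Lemma sum_pairs_tail (S : seq R) (M : nat) (g y : R) : (size S <= n)%N ->
  0 <= g -> 0 < y ->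
  \sum_(j < M) \sum_(p <- allpairs pair S S |
      (0 < p.2 - p.1) && ((p.2 - p.1) * n%:R ^+ 2 < y * 2 ^+ j))
      (96 * g * (p.2 - p.1) / (y * 2 ^+ j)) <= 192 * g.
Proof.
move=> Sn g0 y0; under eq_bigr do rewrite big_mkcond.
have N0 : 0 < n%:R :> R by rewrite ltr0n; lia.
rewrite exchange_big /=.
apply: (@le_trans _ _ (\sum_(p <- allpairs pair S S) (192 * g / n%:R ^+ 2))).
  apply: ler_sum => p _; have [d0|d0] := ltP 0 (p.2 - p.1); last first.
    by rewrite big1 // divr_ge0 ?mulr_ge0 // exprn_ge0 // ltW.
  set T := (p.2 - p.1) * n%:R ^+ 2.
  have T0 : 0 < T by rewrite mulr_gt0 // exprn_gt0.
  rewrite /= -big_mkcond /= -mulr_sumr.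
  have h := geometric_tail M y0 T0.
  have {}h : \sum_(j < M | T < y * 2 ^+ j) (y * 2 ^+ j)^-1 <= 2 / T.
    apply: le_trans h _; rewrite ler_pM2l // lef_pV2 ?posrE ?lt_max ?T0 //.
    by rewrite le_max lexx.
  have -> : 192 * g / n%:R ^+ 2 = 96 * g * (p.2 - p.1) * (2 / T).
    by rewrite /T; field; rewrite !lt0r_neq0.
  by rewrite ler_wpM2l // !mulr_ge0 // ltW.
rewrite big_const_seq count_predT iter_addr_0 size_allpairs -[leLHS]mulr_natl.
rewrite mulrCA -[leRHS]mulr1 ler_wpM2l ?mulr_ge0 // ler_pdivrMr ?exprn_gt0 //.
by rewrite mul1r -natrX ler_nat leq_mul.
Qed.

(** [J] bounds the number of middle scales, each costing 24; the 198 is 6 for the small scales plus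
    192 for the tails. With [J = 2 * (t + 1)] the left side is [246 + 48 * t], at most [294 * t]
    since [1 <= t]. *)
Lemma log_count : exists2 J : nat, n%:R ^+ 2 <= 2 ^+ J :> R &
   198 + 24 * J%:R <= 294 / ln 2 * ln n%:R :> R.
Proof.
set t := trunc_log 2 n.
have t1 : (1 <= t)%N by rewrite trunc_log_gt0.
exists (2 * t.+1)%N.
  rewrite mulnC exprM ler_pXn2r ?nnegrE // -natrX ler_nat ltnW //.
  exact: trunc_log_ltn.
have ln2 : 0 < ln 2 :> R by rewrite ln_gt0 // ltr1n.
have : t%:R * ln 2 <= ln n%:R :> R.
  rewrite mulr_natl -lnXn // ler_ln ?posrE ?exprn_gt0 ?ltr0n //; last lia.
  by rewrite -natrX ler_nat; apply: trunc_logP => //; lia.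
rewrite -ler_pdivlMr // => h.
have t1' : 1 <= t%:R :> R by rewrite ler1n.
rewrite natrM -natr1 -mulrA (mulrC _^-1); lra.
Qed.

Lemma expectation_cutdist (s : seq (update R)) u v : (npoints s <= n)%N ->
  u \in map fst s -> v \in map fst s ->
  (\int[P]_w (cutdist n w s u v)%:E <= (294 / ln 2 * ln n%:R * `|u - v|)%:E)%E.
Proof.
move=> sn us vs; have [<-|uv] := eqVneq u v.
  under eq_integral do rewrite cutdistxx.
  by rewrite integral0 subrr normr0 mulr0.
set g := `|u - v|; have g0 : 0 < g by rewrite normr_gt0 subr_eq0.
(* Scales up to [i0] yield distances of at most [6 * g], whatever the cuts. *)
have [i0 /andP[ig gi]] := scale_bracket g0.
set y : R := 2 ^ (i0 + 1) in gi *; have y0 : 0 < y by exact: scale_gt0.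
pose lev (j : nat) : int := i0 + 1 + j%:Z.
have levE j : 2 ^ lev j = y * 2 ^+ j :> R by rewrite /lev expfzDr ?pnatr_eq0.
(* By [apart_scale], no scale from [lev M] on separates [u] and [v]. *)
have [M hM] : exists M : nat, 4 * (`|u| + `|v|) < y * 2 ^+ M.
  exists (Num.trunc (4 * (`|u| + `|v|) / y)).+1.
  rewrite [ltRHS]mulrC -ltr_pdivrMr //; apply: lt_le_trans (truncnS_gt _) _.
  by rewrite -natrX ler_nat ltnW // ltn_expl.
pose E j := [set w : R * R | apart n w (lev j) s u v].
have mE j : measurable (E j) by exact: measurable_apart.
have [J hJ hlog] := log_count.
set S := undup (map fst s).
pose Q j (p : R * R) := (0 < p.2 - p.1) && ((p.2 - p.1) * n%:R ^+ 2 < y * 2 ^+ j).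
pose tail j := \sum_(p <- allpairs pair S S | Q j p) (96 * g * (p.2 - p.1) / (y * 2 ^+ j)).
have tail0 j : 0 <= tail j.
  apply: sumr_ge0 => p /andP[/ltW p0 _].
  by rewrite divr_ge0 ?mulr_ge0 ?exprn_ge0 // ltW.
(* The first [J] levels are bounded by [prob_apart_near], the others by [prob_apart_far]. *)
pose c j := (if (j < J)%N then 24 * g else 0) + tail j.
have PE j : ((6 * (y * 2 ^+ j))%:E * P (E j) <= (c j)%:E)%E.
  have D0 : 0 < y * 2 ^+ j by rewrite mulr_gt0 // exprn_gt0.
  have gD : g < 2 ^ lev j.
    by rewrite levE (lt_le_trans gi) // ler_peMr ?(ltW y0) // exprn_ege1 // ler1n.
  have [jJ|Jj] := ltnP j J.
    have h := @prob_apart_near R n (lev j) s u v gD; rewrite levE in h.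
    apply: le_trans (lee_pmul _ _ (lexx _) h) _ => //.
      by rewrite lee_fin mulr_ge0 // ltW.
    rewrite -EFinM lee_fin /c jJ -/g.
    have -> : 6 * (y * 2 ^+ j) * (4 * g / (y * 2 ^+ j)) = 24 * g.
      by field; rewrite !lt0r_neq0 // exprn_gt0.
    by rewrite lerDl.
  have gN : g * n%:R ^+ 2 < 2 ^ lev j.
    rewrite levE; apply: le_lt_trans (ler_wpM2l (ltW g0) hJ) _.
    apply: lt_le_trans (_ : y * 2 ^+ J <= _); first by rewrite ltr_pM2r // exprn_gt0.
    by rewrite ler_wpM2l ?(ltW y0) // ler_eXn2l // ltr1n.
  have h := @prob_apart_far R n (lev j) s u v us vs gN gD; rewrite levE in h.
  apply: le_trans (lee_pmul _ _ (lexx _) h) _ => //.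
    by rewrite lee_fin mulr_ge0 // ltW.
  rewrite -EFinM lee_fin /c ltnNge Jj /= add0r /tail mulr_sumr le_eqVlt.
  apply/orP; left; apply/eqP; apply: eq_bigr => p _; rewrite -/g; field.
  by rewrite !lt0r_neq0 // exprn_gt0.
(* The largest separating scale is bounded by the sum of all of them, which makes the bound linear
   in the indicators. *)
pose f2 w := ((6 * g)%:E + \sum_(j < M) ((6 * (y * 2 ^+ j))%:E * (\1_(E j) w)%:E))%E.
have t0 (j : 'I_M) (w : R * R) : (0 <= (6 * (y * 2 ^+ j))%:E * (\1_(E j) w)%:E)%E.
  by rewrite -EFinM lee_fin !mulr_ge0 ?exprn_ge0 ?(ltW y0) // indicE.
have mt (j : 'I_M) : measurable_fun [set: measurableTypeR R * measurableTypeR R]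
    (fun w : R * R => ((6 * (y * 2 ^+ j))%:E * (\1_(E j) w)%:E)%E).
  by apply: measurable_funeM; apply/measurable_EFinP; apply: measurable_indic; exact: mE.
apply: (@le_trans _ _ (\int[P]_w f2 w)%E).
  apply: ge0_le_integral => //.
  - by move=> w _; rewrite lee_fin cutdist_ge0.
  - by apply/measurable_EFinP; exact: measurable_cutdist.
  - apply: emeasurable_funD; first exact: measurable_cst.
    by apply: emeasurable_sum => j; exact: mt.
  move=> w _; rewrite /f2; under eq_bigr do rewrite -EFinM.
  rewrite sumEFin -EFinD lee_fin.
  have st j : 0 <= 6 * (y * 2 ^+ j) * \1_(E j) w :> R.
    by rewrite !mulr_ge0 ?exprn_ge0 ?(ltW y0) // indicE.
  apply: cutdist_le => [|i ai].
    by rewrite addr_ge0 ?mulr_ge0 ?(ltW g0) // sumr_ge0.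
  have [ii|ii] := leP i i0.
    have : 2 ^ i <= 2 ^ i0 :> R by rewrite ler_eXz2l // ltr1n.
    have : 0 <= \sum_(j < M) 6 * (y * 2 ^+ j) * \1_(E j) w :> R by rewrite sumr_ge0.
    lra.
  have [j ij] : exists j : nat, i = lev j.
    by exists `|(i - i0 - 1)%R|%N; rewrite /lev; lia.
  have jM : (j < M)%N.
    have := le_lt_trans (apart_scale ai) hM.
    by rewrite ij levE ltr_pM2l // ltr_eXn2l // ltr1n.
  rewrite (bigD1 (Ordinal jM)) //= indicE mem_set ?mulr1; last by rewrite /E /= -ij.
  rewrite ij levE.
  have : 0 <= \sum_(k < M | k != Ordinal jM) 6 * (y * 2 ^+ k) * \1_(E k) w :> R.
    by rewrite sumr_ge0.
  lra.
rewrite /f2 ge0_integralD //; last first.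
- by apply: emeasurable_sum => j; exact: mt.
- by move=> w _; apply: sume_ge0.
- by move=> w _; rewrite lee_fin mulr_ge0 // ltW.
have -> : (\int[P]_w (6 * g)%:E = (6 * g)%:E)%E.
  by rewrite integral_cst // [X in (_ * X)%E]probability_setT mule1.
rewrite ge0_integral_sum //.
apply: (@le_trans _ _ ((6 * g)%:E + \sum_(j < M) (c j)%:E)%E).
  apply: leeD => //; apply: lee_sum => j _.
  rewrite ge0_integralZl_EFin //; last first.
  - by rewrite !mulr_ge0 ?exprn_ge0 // ltW.
  - by apply/measurable_EFinP; apply: measurable_indic; exact: mE.
  suff -> : (\int[P]_w (\1_(E j) w)%:E = P (E j))%E by exact: PE.
  by rewrite -[in RHS](setIT (E j)); apply: integral_indic => //; exact: mE.
rewrite sumEFin -EFinD lee_fin /c big_split /= sum_lt_const.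
have h1 : \sum_(j < M) tail j <= 192 * g by apply: sum_pairs_tail => //; exact: ltW.
have h2 : (minn M J)%:R * (24 * g) <= J%:R * (24 * g).
  by rewrite ler_wpM2r ?mulr_ge0 ?(ltW g0) // ler_nat geq_minr.
have := ler_wpM2r (ltW g0) hlog; lra.
Qed.

End ExpectedDistortion.

Theorem mainTheorem17 (R : realType) :
  exists2 C : R, 0 < C &
    forall n : nat, (1 < n)%N ->
      prob_online_monotone_embedding n (C * ln (n%:R)).
Proof.
exists (294 / ln 2); first by rewrite divr_gt0 // ln_gt0 // ltr1n.
move=> n n1.
exists _, (measurableTypeR R * measurableTypeR R)%type, (cut_prob R),
  (fun w s u v => cutdist n w s u v); split=> [w|s sn u v us vs].
  split=> [s _|s a _ u v _ _ _ _]; last exact: cutdist_rcons.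
  split=> [|u v _ _]; last exact: norm_le_cutdist.
  (* Alive points are among those that have occurred in the sequence, a finite list. *)
  apply: (@ultrametric_is_HST _ _ (map fst s)).
  - exact: alive_mem.
  - exact: cutdistxx.
  - exact: cutdistC.
  - move=> x y xy; apply: lt_le_trans (norm_le_cutdist _ _ _ _ _).
    by rewrite normr_gt0 subr_eq0.
  - by move=> x y z; exact: cutdist_max.
split; first exact: measurable_cutdist.
by apply: expectation_cutdist => //; exact: alive_mem.
Qed.
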